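(* Let $\mathcal{A}$ be a subspace arrangement in $k^n$ with defining linear ideals $I_1,\dots,I_r\subseteq k[x_1,\dots,x_n]$, embedded in a central hyperplane arrangement $\mathcal{H}$, and let $\tilde{\mathcal{H}}\supseteq\mathcal{H}$ be a central hyperplane arrangement obtained by adding finitely many hyperplanes such that for every choice $1\le i_1<\dots<i_t\le r$ some subset of the linear forms defining the hyperplanes of $\tilde{\mathcal{H}}$ is a basis of the $k$-vector space of linear forms contained in $I_{i_1}\cap\dots\cap I_{i_t}$. Then the ideal generated by all products of linear forms contained in $I_{\mathcal{A}}=I_1\cap\dots\cap I_r$ is equal to $F_{\mathcal{A},\tilde{\mathcal{H}}}$.
   Context: $k$ is an infinite field. A subspace arrangement in $k^n$ is a finite set of linear subspaces, none containing another; it is embedded in a hyperplane arrangement if each subspace is an intersection of some of its hyperplanes. For a hyperplane arrangement $\mathcal{G}$ with defining linear forms $m_1,\dots,m_s$ in which $\mathcal{A}$ is embedded, the $\mathcal{G}$-product ideal is $F_{\mathcal{A},\mathcal{G}}=(m_{j_1}\cdots m_{j_q}\mid$ each $m_{j_u}\in\{m_1,\dots,m_s\}$, and for every $1\le i\le r$ there is $u$ with $m_{j_u}\in I_i)$. *)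

(* Defs.v *)
From HB Require Import structures.
From mathcomp Require Import all_boot all_order all_algebra.
From mathcomp Require Import finmap.
From mathcomp.multinomials Require Import mpoly.

Set Implicit Arguments.
Unset Strict Implicit.
Unset Printing Implicit Defensive.

Import GRing.Theory.
Local Open Scope ring_scope.
Local Open Scope fset_scope.

Definition infinite_type (T : eqType) : Prop :=
  forall s : seq T, exists x : T, x \notin s.

Definition ideal_gen (R : comNzRingType) (S : R -> Prop) : R -> Prop :=
  fun p => exists s : seq (R * R),
    (forall ag, ag \in s -> S ag.2) /\ p = \sum_(ag <- s) ag.1 * ag.2.

Definition is_basis (k : fieldType) (E : lmodType k) (T : choiceType)
    (C : {fset T}) (b : T -> E) (L : E -> Prop) : Prop :=
  (forall c : T -> k,
      \sum_(t <- C) c t *: b t = 0 -> forall t, t \in C -> c t = 0) /\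
  (forall v : E, L v <-> exists c : T -> k, v = \sum_(t <- C) c t *: b t).

Section Arrangements.

Variables (k : fieldType) (n : nat).

Local Notation space := {vspace 'rV[k]_n}.
Local Notation poly := {mpoly k[n]}.

Implicit Types (V W : space) (A B G : {fset space}) (p l : poly).

Definition subspace_arrangement A : Prop :=
  forall V W, V \in A -> W \in A -> (V <= W)%VS -> V = W.

Definition hyperplane_arrangement G : Prop :=
  forall W, W \in G -> (\dim W).+1 = n.

(* The empty intersection is the whole space k^n. *)
Definition embedded A G : Prop :=
  forall V, V \in A ->
    exists2 B, B `<=` G & V = (\bigcap_(W <- B) W)%VS.

(* The zero polynomial counts as a linear form. *)
Definition linear_form l : Prop := l \is 1.-homog.

Definition eval_at p (x : 'rV[k]_n) : k := p.@[fun i => x 0 i].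

Definition defining_form l W : Prop :=
  linear_form l /\ forall x : 'rV[k]_n, x \in W <-> eval_at l x = 0.

Definition defining_forms (m : space -> poly) G : Prop :=
  forall W, W \in G -> defining_form (m W) W.

Definition linear_ideal V : poly -> Prop :=
  ideal_gen (fun l => linear_form l /\ forall x, x \in V -> eval_at l x = 0).

(* The intersection of the linear ideals of the members of A. *)
Definition arrangement_ideal A : poly -> Prop :=
  fun p => forall V, V \in A -> linear_ideal V p.

Definition products_of_linear_forms_ideal A : poly -> Prop :=
  ideal_gen (fun p =>
    (exists2 s : seq poly, (forall l, l \in s -> linear_form l)
                         & p = \prod_(l <- s) l)
    /\ arrangement_ideal A p).

(* The ideal F_{A,G}; repeated factors are allowed in the sequence s. *)
Definition product_ideal A G (m : space -> poly) : poly -> Prop :=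
  ideal_gen (fun p =>
    exists s : seq space,
      [/\ forall W, W \in s -> W \in G,
          forall V, V \in A -> exists2 W, W \in s & linear_ideal V (m W)
        & p = \prod_(W <- s) m W]).

End Arrangements.

(* Main.v *)
(* A linear ideal contains a product of linear forms only if it contains one of
   them, since over an infinite field a subspace is not a finite union of proper
   subspaces. Given a product of linear forms in the arrangement ideal, let [B]
   be the set of members of [A] on which the factor [l] vanishes, and expand [l]
   in the basis attached to [B] whenever [B] is nonempty: each monomial of the
   expanded product still has, for every member of [A], a factor in its ideal. *)
Require Import Defs.
From mathcomp Require Import all_boot all_order all_algebra.
From mathcomp Require Import finmap.
From mathcomp.multinomials Require Import mpoly.

Set Implicit Arguments.
Unset Strict Implicit.
Unset Printing Implicit Defensive.

Import GRing.Theory.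
Local Open Scope fset_scope.
Local Open Scope ring_scope.

Section IdealGen.
Variable R : comNzRingType.
Implicit Types (S T : R -> Prop) (p q h : R).

Lemma ideal_gen_mem S p : S p -> ideal_gen S p.
Proof.
move=> Sp; exists [:: (1, p)]; split; last by rewrite big_seq1 mul1r.
by move=> ag; rewrite inE => /eqP->.
Qed.

Lemma ideal_gen0 S : ideal_gen S 0.
Proof. by exists [::]; rewrite big_nil. Qed.

Lemma ideal_genD S p q : ideal_gen S p -> ideal_gen S q -> ideal_gen S (p + q).
Proof.
move=> [s [Ss ->]] [t [St ->]]; exists (s ++ t); rewrite big_cat; split=> // ag.
by rewrite mem_cat => /orP[/Ss|/St].
Qed.

Lemma ideal_gen_sum S (I : eqType) (r : seq I) (F : I -> R) :
  (forall i, i \in r -> ideal_gen S (F i)) -> ideal_gen S (\sum_(i <- r) F i).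
Proof.
elim: r => [|i r IHr] SF; first by rewrite big_nil; apply: ideal_gen0.
rewrite big_cons; apply: ideal_genD; first by apply: SF; rewrite mem_head.
by apply: IHr => j rj; apply: SF; rewrite inE rj orbT.
Qed.

(** Multiplication by [h] is linear, so generators suffice. Allowing [S] and [T] to differ covers
    both inclusions of ideals ([h = 1]) and the passage from one product ideal to another by an
    extra factor. *)
Lemma ideal_gen_mull_sub S T h p :
  (forall g, S g -> ideal_gen T (h * g)) -> ideal_gen S p ->
  ideal_gen T (h * p).
Proof.
move=> ST [s [Ss ->]]; rewrite big_distrr /=; apply: ideal_gen_sum => ag /Ss.
move=> /ST[t [Tt ht]]; exists [seq (ag.1 * bg.1, bg.2) | bg <- t]; split.
  by move=> _ /mapP[bg /Tt Tbg ->].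
rewrite big_map mulrCA ht big_distrr /=.
by apply: eq_bigr => bg _; rewrite mulrA.
Qed.

Lemma ideal_gen_mull S h p : ideal_gen S p -> ideal_gen S (h * p).
Proof.
apply: ideal_gen_mull_sub => g Sg; exists [:: (h, g)].
by rewrite big_seq1; split=> // ag; rewrite inE => /eqP->.
Qed.

Lemma ideal_gen_sub S T p :
  (forall g, S g -> ideal_gen T g) -> ideal_gen S p -> ideal_gen T p.
Proof.
by move=> ST Sp; rewrite -[p]mul1r; apply: ideal_gen_mull_sub Sp => g /ST;
  rewrite mul1r.
Qed.

Lemma ideal_gen_prod S (I : eqType) (r : seq I) (F : I -> R) (i : I) :
  i \in r -> ideal_gen S (F i) -> ideal_gen S (\prod_(j <- r) F j).
Proof.
by move=> ri SFi; rewrite (big_rem i ri) /= mulrC; apply: ideal_gen_mull.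
Qed.

End IdealGen.

Section LinearForms.
Variables (k : fieldType) (n : nat).
Implicit Types (V : {vspace 'rV[k]_n}) (l : {mpoly k[n]}) (x y : 'rV[k]_n).

Lemma eval_at_linear_form l x :
  linear_form l -> eval_at l x = \sum_i l@_U_(i)%MM * x 0 i.
Proof.
move=> l1; rewrite /eval_at.
have {1}-> : l = \sum_i l@_U_(i)%MM *: 'X_i.
  apply/mpolyP=> d; rewrite raddf_sum /=.
  under eq_bigr => i _ do rewrite mcoeffZ mcoeffX.
  (* A monomial of degree 1 is a variable; at any other degree both coefficients are 0, the left one
     by homogeneity. *)
  have [/eqP/mdeg1P[i /eqP ->]|dN1] := eqVneq (mdeg d) 1.
    rewrite (bigD1 i) //= eqxx mulr1 big1 ?addr0 // => j jNi.
    case: eqP => [/mnmP/(_ j)|]; last by rewrite mulr0.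
    by rewrite !mnm1E eqxx eq_sym (negPf jNi).
  rewrite (dhomog_nemf_coeff l1 dN1) big1 // => i _.
  by case: eqP => [e|]; [rewrite -e mdeg1 eqxx in dN1 | rewrite mulr0].
rewrite raddf_sum /=; apply: eq_bigr => i _.
by rewrite mevalZ mevalXU.
Qed.

Lemma eval_atDZ l x y (t : k) :
  linear_form l -> eval_at l (x + t *: y) = eval_at l x + t * eval_at l y.
Proof.
move=> l1; rewrite !eval_at_linear_form // big_distrr -big_split /=.
by apply: eq_bigr => i _; rewrite !mxE mulrDr mulrCA.
Qed.

(** Testing on a basis makes the condition boolean, so that it can select a finite subset of an
    arrangement. *)
Definition vanishes_on l V : bool :=
  all (fun b => eval_at l b == 0) (vbasis V).

Lemma vanishes_onP l V :
  linear_form l ->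
  reflect (forall x, x \in V -> eval_at l x = 0) (vanishes_on l V).
Proof.
move=> l1; apply: (iffP allP) => [l0 x Vx|l0 b /vbasis_mem/l0->//].
rewrite (coord_vbasis Vx).
elim/big_rec: _ => [|i y _ ly].
  by rewrite eval_at_linear_form // big1 // => i _; rewrite mxE mulr0.
rewrite addrC eval_atDZ // ly add0r (eqP (l0 _ _)) ?mulr0 //.
by rewrite mem_nth // size_tuple.
Qed.

Lemma linear_ideal_eval0 V (p : {mpoly k[n]}) x :
  linear_ideal V p -> x \in V -> eval_at p x = 0.
Proof.
move=> [s [sV ->]] Vx; rewrite /eval_at raddf_sum /= big_seq big1 // => ag sag.
by rewrite mevalM; have [_ /(_ x Vx)] := sV ag sag; rewrite /eval_at => ->;
  rewrite mulr0.
Qed.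

Lemma linear_idealE l V :
  linear_form l -> linear_ideal V l <-> vanishes_on l V.
Proof.
move=> l1; split=> [lV|/vanishes_onP lV].
  by apply/vanishes_onP => // x; apply: linear_ideal_eval0.
by apply: ideal_gen_mem; split=> //; apply: lV.
Qed.

(* If [x] avoids the zeros of the forms in [s] and [l y <> 0], then so does
   [x + t *: y], and [l] does not vanish there, for all but finitely many [t]. *)
Lemma common_nonzero V (s : seq {mpoly k[n]}) :
  infinite_type k -> (forall l, l \in s -> linear_form l) ->
  ~~ has (fun l => vanishes_on l V) s ->
  exists2 x, x \in V & forall l, l \in s -> eval_at l x != 0.
Proof.
move=> kinf; elim: s => [|l s IHs] s1; first by exists 0; rewrite ?mem0v.
have s1' l' : l' \in s -> linear_form l'.
  by move=> sl; apply: s1; rewrite inE sl orbT.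
rewrite /= negb_or => /andP[/allPn[y /vbasis_mem Vy ly] /(IHs s1')[x Vx sx]].
(* Each entry with [eval_at l' y != 0] is the only root in [t] of [l'] at [x + t *: y]; the other
   entries are 0 by the convention on division and exclude nothing that matters. *)
have [t tN] := kinf [seq - eval_at l' x / eval_at l' y | l' <- l :: s].
exists (x + t *: y) => [|l' l's]; first by rewrite memvD ?memvZ.
rewrite eval_atDZ; last exact: s1.
(* If [l'] vanishes at [y], it is not [l], so it lies in [s] and keeps its nonzero value at [x]. *)
have [ly0|lyN0] := eqVneq (eval_at l' y) 0.
  rewrite ly0 mulr0 addr0; apply: sx.
  by move: l's; rewrite inE => /predU1P[ll|//]; rewrite -ll ly0 eqxx in ly.
apply: contra tN; rewrite addrC addr_eq0 => /eqP txy.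
by apply/mapP; exists l'; rewrite // -txy mulfK.
Qed.

(** Otherwise some point of [V] avoids the zeros of all factors, and the product is nonzero there,
    although members of the ideal vanish on [V]. *)
Lemma linear_ideal_prod_vanishes V (s : seq {mpoly k[n]}) :
  infinite_type k -> (forall l, l \in s -> linear_form l) ->
  linear_ideal V (\prod_(l <- s) l) -> has (fun l => vanishes_on l V) s.
Proof.
move=> kinf s1 sV; apply/negPn/negP => /(common_nonzero kinf s1)[x Vx sx].
have /eqP := linear_ideal_eval0 sV Vx.
rewrite /eval_at rmorph_prod /= prodf_seq_eq0 => /hasP[l /sx]/=.
by rewrite /eval_at => /negPf->.
Qed.

End LinearForms.

Section Product.

Lemma is_basis_mem (k : fieldType) (E : lmodType k) (T : choiceType)
    (C : {fset T}) (b : T -> E) (L : E -> Prop) t :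
  is_basis C b L -> t \in C -> L (b t).
Proof.
move=> [_ CL] Ct; apply/CL; exists (fun u => (u == t)%:R).
rewrite (big_fsetD1 t) //= eqxx scale1r big_seq big1 ?addr0 // => u.
by rewrite !inE => /andP[/negPf-> _]; rewrite scale0r.
Qed.

Variables (k : fieldType) (n : nat) (A Ht : {fset {vspace 'rV[k]_n}}).
Variable m : {vspace 'rV[k]_n} -> {mpoly k[n]}.
Hypothesis basesHt :
  forall B : {fset {vspace 'rV[k]_n}}, B `<=` A -> B != fset0 ->
    exists2 C : {fset {vspace 'rV[k]_n}}, C `<=` Ht
      & is_basis C m (fun l => linear_form l /\ arrangement_ideal B l).

(* Each factor [l] is expanded in the basis attached to the set of members of
   [D] on which [l] vanishes. *)
Lemma prod_linear_forms_product_ideal (D : {fset {vspace 'rV[k]_n}}) s :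
  D `<=` A -> (forall l, l \in s -> linear_form l) ->
  (forall V, V \in D -> has (fun l => vanishes_on l V) s) ->
  product_ideal D Ht m (\prod_(l <- s) l).
Proof.
elim: s D => [|l s IHs] D DA s1 Ds.
  (* Without factors, [Ds] forces [D] to be empty, and the empty product 1 is a generator. *)
  by apply: ideal_gen_mem; exists [::]; split=> [//|V /Ds//|]; rewrite !big_nil.
have l1 : linear_form l by apply: s1; rewrite mem_head.
have s1' l' : l' \in s -> linear_form l'.
  by move=> sl; apply: s1; rewrite inE sl orbT.
rewrite big_cons.
pose B := [fset V in D | vanishes_on l V].
have BA : B `<=` A.
  by apply: fsubset_trans DA; apply/fsubsetP => V; rewrite !inE => /andP[].
have {}IHs : product_ideal (D `\` B) Ht m (\prod_(l <- s) l).
  apply: IHs => // [|V]; first by apply: fsubset_trans (fsubsetDl _ _) DA.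
  rewrite !inE => /andP[+ DV].
  by have := Ds V DV; rewrite DV /=; case: vanishes_on.
(* An empty [B] has no basis attached, but then [l] only multiplies an element already in the ideal
   for [D]. *)
have [B0|BN0] := eqVneq B fset0.
  by rewrite B0 fsetD0 in IHs; apply: ideal_gen_mull.
have [C CHt Cbasis] := basesHt BA BN0.
have [c ->] : exists c : _ -> k, l = \sum_(t <- C) c t *: m t.
  case: (Cbasis) => _ /(_ l)[+ _]; apply; split=> // V.
  by rewrite !inE => /andP[_]; rewrite -linear_idealE.
rewrite big_distrl /=; apply: ideal_gen_sum => t Ct.
rewrite -mul_mpolyC -mulrA; apply: ideal_gen_mull.
apply: ideal_gen_mull_sub IHs => _ [r [rHt rD ->]]; apply: ideal_gen_mem.
exists (t :: r); split=> [W|V DV|]; last by rewrite big_cons.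
  by rewrite inE => /predU1P[->|/rHt//]; apply: (fsubsetP CHt).
(* The new factor [m t] serves the members of [B], the old factors in [r] serve the rest of [D]. *)
have [BV|BNV] := boolP (V \in B).
  by exists t; [rewrite mem_head | case: (is_basis_mem Cbasis Ct) => _; apply].
have [|W rW WV] := rD V; first by rewrite inE BNV.
by exists W; rewrite // inE rW orbT.
Qed.

End Product.

Theorem theorem4p7 (k : fieldType) (n : nat)
    (A H Ht : {fset {vspace 'rV[k]_n}})
    (m : {vspace 'rV[k]_n} -> {mpoly k[n]}) :
  infinite_type k ->
  subspace_arrangement A ->
  hyperplane_arrangement H ->
  embedded A H ->
  hyperplane_arrangement Ht ->
  H `<=` Ht ->
  defining_forms m Ht ->
  (forall B : {fset {vspace 'rV[k]_n}}, B `<=` A -> B != fset0 ->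
     exists2 C : {fset {vspace 'rV[k]_n}}, C `<=` Ht
       & is_basis C m (fun l => linear_form l /\ arrangement_ideal B l)) ->
  forall p : {mpoly k[n]},
    products_of_linear_forms_ideal A p <-> product_ideal A Ht m p.
Proof.
move=> kinf _ _ _ _ _ mHt basesHt p; split; apply: ideal_gen_sub => g.
  move=> [[s s1 {g}->] sA]; apply: (@prod_linear_forms_product_ideal _ _ A) => //.
  by move=> V /sA; apply: linear_ideal_prod_vanishes.
move=> [s [sHt sA {g}->]]; apply: ideal_gen_mem; split.
  exists [seq m W | W <- s]; last by rewrite big_map.
  by move=> _ /mapP[W /sHt/mHt mW ->]; case: mW.
by move=> V /sA[W sW]; apply: ideal_gen_prod.
Qed.
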